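(* Let $\mathbb{F}_q$ be a finite field and $N=d^n$ for positive integers $d\ge2,n$ with $\gcd(d,q)=1$. Let $\omega$ be a primitive $d$-th root of unity in some extension of $\mathbb{F}_q$. Let $0<\epsilon<0.01$ and assume $n\ge1/\psi$ where \[ \psi=\frac{\epsilon^2}{400\log^2(1/\epsilon)\,d\log d}. \] Let $H_{d,n}=\underbrace{\mathrm{DFT}_d\otimes\cdots\otimes\mathrm{DFT}_d}_{n}$. Then $\textsf{r}^{\mathbb{F}_q[\omega]}_{H_{d,n}}\left(N^{1-\psi}\right)\le N^{\epsilon}$.
   Context: Here $\mathrm{DFT}_d$ is the $d\times d$ matrix over $\mathbb{F}_q[\omega]$ with $(x,y)$ entry $\omega^{xy}$, $0\le x,y\le d-1$; $\otimes$ is the Kronecker product. $\textsf{r}^{\mathbb{F}}_M(r)$ is the smallest $s$ such that $M=E+F$ over $\mathbb{F}$ with $E$ having at most $s$ nonzero entries in each row and column and $\operatorname{rank}(F)\le r$. *)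

(* Defs.v *)
From HB Require Import structures.
From mathcomp Require Import all_boot all_order all_algebra all_field.
From mathcomp Require Import interval_inference.
From mathcomp.real_closed Require Import mxtens.
From mathcomp Require Import boolp reals exp.

Set Implicit Arguments.
Unset Strict Implicit.
Unset Printing Implicit Defensive.

Import Order.TTheory GRing.Theory Num.Theory.
Local Open Scope ring_scope.

Definition sparse (K : fieldType) (m s : nat) (A : 'M[K]_m) : Prop :=
  (forall i, (#|[set j | A i j != 0%R]| <= s)%N) /\
  (forall j, (#|[set i | A i j != 0%R]| <= s)%N).

(* The rank bound [r] is a real number, since it is used at values such as
   N^(1 - psi). *)
Definition rigid_decomp (R : realType) (K : fieldType) (m : nat)
    (M : 'M[K]_m) (r : R) (s : nat) : Prop :=
  exists E F : 'M[K]_m, [/\ M = E + F, sparse s E & (\rank F)%:R <= r].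

Lemma rigid_decomp_ex (R : realType) (K : fieldType) (m : nat)
    (M : 'M[K]_m) (r : {nonneg R}) : exists s, `[< rigid_decomp M r%:num s >].
Proof.
have sM : sparse m M.
  by split=> i; rewrite -[X in (_ <= X)%N]card_ord max_card.
exists m; apply/asboolP; exists M, 0.
split=> //; first by rewrite addr0.
by rewrite mxrank0 ge0.
Qed.

(* [r] is nonnegative so that the minimum is over a nonempty set: [s = m] is
   always admissible, via [E = M] and [F = 0]. *)
Definition rigidity (R : realType) (K : fieldType) (m : nat)
    (M : 'M[K]_m) (r : {nonneg R}) : nat := ex_minn (rigid_decomp_ex M r).

Definition DFT (K : fieldType) (w : K) (d : nat) : 'M[K]_d :=
  \matrix_(x < d, y < d) w ^+ (x * y).

(* [A ^t n] is the n-fold Kronecker power of [A], of size [d ^ n]. *)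
Definition Hmx (K : fieldType) (w : K) (d n : nat) : 'M[K]_(d ^ n) :=
  DFT w d ^t n.

(* [adjoin w] is the field F[w], as a type; [adjoin_gen w] is [w] in it. *)
Definition adjoin (F : fieldType) (L : fieldExtType F) (w : L) :
  fieldExtType F := subvs_of <<1; w>>%AS.

Definition adjoin_gen (F : fieldType) (L : fieldExtType F) (w : L) :
  adjoin w := Subvs (memv_adjoin 1%AS w).

Definition psi (R : realType) (d : nat) (eps : R) : R :=
  eps ^+ 2 / (400 * ln (1 / eps) ^+ 2 * d%:R * ln d%:R).

(* Main.v *)
(* The DFT matrix is a Vandermonde matrix, so replacing its last [d - k] rows by
   those of the identity leaves an invertible matrix [DFT_top k]. Consecutive
   quotients [DFT_top k.+1 * (DFT_top k)^-1] differ from the identity in row [k]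
   only, and their product is the DFT matrix.

   Let [G] differ from the identity in row [k] only. An entry [(x, y)] of the
   Kronecker power of [G] vanishes unless [x i = y i] or [x i = k] for all [i].
   By a Chernoff bound, few [x] take the value [k] more than [(1/d + eta) n]
   times, and few [y] fewer than [(1/d - eta) n] times; these rows and columns
   form the low-rank part. In the remaining entries [x] and [y] differ in at
   most [2 eta n] coordinates, so that part is sparse. In a product of
   decompositions ranks add and sparsities multiply; taking [eta] of order
   [eps / (d ln (1/eps))] makes the [d] factors together satisfy both bounds. *)
Require Import Defs.
From HB Require Import structures.
From mathcomp Require Import all_boot all_order all_algebra all_field.
From mathcomp Require Import interval_inference.
From mathcomp.real_closed Require Import mxtens.
From mathcomp Require Import boolp reals exp.
From mathcomp Require Import sequences ring lra.

Set Implicit Arguments.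
Unset Strict Implicit.
Unset Printing Implicit Defensive.

Import Order.TTheory GRing.Theory Num.Theory.
Local Open Scope ring_scope.

(** * Entries of Kronecker powers, and ranks of matrices with few nonzero rows or columns *)

Lemma ntensmx_digits (d n : nat) :
  exists2 g : 'I_(d ^ n) -> {ffun 'I_n -> 'I_d}, bijective g &
    forall (K : pzRingType) (A : 'M[K]_d) x y,
      (A ^t n) x y = \prod_i A (g x i) (g y i).
Proof.
suff [g injg gE] : exists2 g : 'I_(d ^ n) -> {ffun 'I_n -> 'I_d}, injective g &
    forall (K : pzRingType) (A : 'M[K]_d) x y,
      (A ^t n) x y = \prod_i A (g x i) (g y i).
  by exists g => //; apply: inj_card_bij => //; rewrite card_ffun !card_ord.
case: n => [|n].
  exists (fun=> ffun0 (card_ord 0)).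
    by move=> x y _; apply/val_inj; case: x y => [[|x] hx] [[|y] hy].
  move=> K A x y; rewrite big_ord0 ntensmx0 mxE.
  by case: x y => [[|x] hx] [[|y] hy].
elim: n => [|n [g injg gE]].
  exists (fun x => [ffun=> x]).
    by move=> x y /ffunP/(_ ord0); rewrite !ffunE.
  by move=> K A x y; rewrite ntensmx1 big_ord1 !ffunE.
(* Coordinate [0] belongs to the leftmost Kronecker factor. The induction starts at exponent 1
   because [ntensmxSS] unfolds only exponents from 2 on. *)
pose g' (x : 'I_(d * d ^ n.+1)) : {ffun 'I_n.+2 -> 'I_d} :=
  [ffun i => if unlift ord0 i is Some j then g (mxtens_unindex x).2 j
             else (mxtens_unindex x).1].
exists g'.
  move=> x y /ffunP g'E; rewrite -[x]mxtens_unindexK -[y]mxtens_unindexK.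
  congr mxtens_index; apply/eqP; rewrite -pair_eqE; apply/andP; split.
    by have := g'E ord0; rewrite !ffunE unlift_none => /eqP.
  apply/eqP/injg/ffunP => j.
  by have := g'E (lift ord0 j); rewrite !ffunE liftK.
move=> K A x y; rewrite ntensmxSS mxE gE [RHS]big_ord_recl.
by rewrite !ffunE unlift_none; congr (_ * _); apply: eq_bigr => j _;
  rewrite !ffunE liftK.
Qed.

Lemma ntensmxM (K : comPzRingType) (d n : nat) (A B : 'M[K]_d) :
  (A *m B) ^t n = A ^t n *m B ^t n.
Proof.
case: n => [|n]; first by rewrite !ntensmx0 mul1mx.
by elim: n => [|n IHn]; rewrite ?ntensmx1 // !ntensmxSS IHn -tensmx_mul.
Qed.

Lemma ntensmx_scalar1 (K : comPzRingType) (d n : nat) :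
  (1%:M : 'M[K]_d) ^t n = 1%:M.
Proof.
case: n => [|n]; first by rewrite ntensmx0.
elim: n => [|n IHn]; rewrite ?ntensmx1 // ntensmxSS IHn.
apply/matrixP => i j; rewrite !mxE -natrM mulnb.
by rewrite -[in RHS](can_eq (@mxtens_unindexK _ _)) xpair_eqE.
Qed.

Lemma mxrank_le_rows (K : fieldType) (m n : nat) (A : 'M[K]_(m, n))
    (S : {set 'I_m}) :
  (forall i j, i \notin S -> A i j = 0) -> (\rank A <= #|S|)%N.
Proof.
move=> A0; have -> : A = \sum_(i in S) delta_mx i ord0 *m row i A.
  apply/matrixP => i j; rewrite summxE; case: (boolP (i \in S)) => iS.
    rewrite (bigD1 i) //= big1 ?addr0 => [|k /andP[_ ki]].
      by rewrite mxE big_ord1 !mxE !eqxx mul1r.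
    by rewrite mxE big_ord1 !mxE eq_sym (negPf ki) mul0r.
  rewrite A0 // big1 // => k kS; rewrite mxE big_ord1 !mxE.
  by case: eqP iS => [->|]; rewrite ?kS // mul0r.
rewrite -sum1_card; elim/big_rec2: _ => [|i u v _ IH]; first by rewrite mxrank0.
apply: leq_trans (mxrank_add _ _) _; apply: leq_add => //.
by rewrite (leq_trans (mxrankM_maxr _ _)) ?rank_leq_row.
Qed.

Lemma mxrank_le_cols (K : fieldType) (m n : nat) (A : 'M[K]_(m, n))
    (S : {set 'I_n}) :
  (forall i j, j \notin S -> A i j = 0) -> (\rank A <= #|S|)%N.
Proof.
by move=> A0; rewrite -mxrank_tr mxrank_le_rows // => i j iS; rewrite mxE A0.
Qed.

(** * Arithmetic of sparse plus low-rank decompositions *)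

Section Decomposition.
Variables (R : realType) (K : fieldType).

Definition row_sparse m (E : 'M[K]_m) (b : R) : Prop :=
  forall i, #|[set j | E i j != 0]|%:R <= b.

(** The sparsity bound is real so that it can be an exponential; [rigidity_le] rounds it down once,
    at the end. Columns are treated as rows of the transpose, so [row_sparseM] serves both. *)
Definition decomp m (A : 'M[K]_m) (r b : R) : Prop :=
  exists E F : 'M[K]_m,
    [/\ A = E + F, row_sparse E b, row_sparse E^T b & (\rank F)%:R <= r].

Lemma row_sparseM m (A B : 'M[K]_m) (a b : R) :
  row_sparse A a -> row_sparse B b -> row_sparse (A *m B) (a * b).
Proof.
move=> sA sB i; pose S := [set k | A i k != 0].
have sub : [set j | (A *m B) i j != 0] \subset
    \bigcup_(k in S) [set j | B k j != 0].
  apply/subsetP => j; rewrite inE; apply: contraR => /bigcupP nS.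
  rewrite mxE big1 // => k _; apply/eqP; rewrite mulf_eq0.
  by apply/negPn/negP => /norP[Aik Bkj]; apply: nS; exists k; rewrite inE.
have b0 : 0 <= b by apply: le_trans (sB i).
apply: (@le_trans _ _ (\sum_(k in S) #|[set j | B k j != 0]|%:R)).
  rewrite -natr_sum ler_nat (leq_trans (subset_leq_card sub)) //.
  elim/big_rec2: _ => [|k u v _ IH]; first by rewrite cards0.
  by rewrite (leq_trans (leq_card_setU _ _)) // leq_add2l.
apply: (@le_trans _ _ (\sum_(k in S) b)); first by apply: ler_sum.
by rewrite sumr_const -mulr_natl ler_wpM2r //; apply: sA.
Qed.

Lemma decomp_le m (A : 'M[K]_m) (r s a b : R) :
  r <= s -> a <= b -> decomp A r a -> decomp A s b.
Proof.
move=> rs ab [E [F [AE rE cE rF]]]; exists E, F; split => //.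
- by move=> i; apply: le_trans ab.
- by move=> i; apply: le_trans ab.
- exact: le_trans rs.
Qed.

Lemma decompM m (A B : 'M[K]_m) (r s a b : R) :
  decomp A r a -> decomp B s b -> decomp (A *m B) (r + s) (a * b).
Proof.
move=> [E [F [-> rE cE rF]]] [E' [F' [-> rE' cE' rF']]].
(* Keeping [E' + F'] together leaves only two low-rank terms, with ranks at most those of [F'] and
   [F]. *)
exists (E *m E'), (E *m F' + F *m (E' + F')); split.
- by rewrite mulmxDl mulmxDr addrA.
- exact: row_sparseM.
- by rewrite trmx_mul mulrC; apply: row_sparseM.
- rewrite [r + s]addrC (le_trans _ (lerD rF' rF)) // -natrD ler_nat.
  rewrite (leq_trans (mxrank_add _ _)) // leq_add //; first exact: mxrankM_maxr.
  exact: mxrankM_maxl.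
Qed.

Lemma decomp1 m : decomp (1%:M : 'M[K]_m) 0 1.
Proof.
have sp : row_sparse (1%:M : 'M[K]_m) 1.
  move=> i; rewrite lern1; apply: leq_trans (_ : _ <= #|[set i]|)%N _.
    apply: subset_leq_card; apply/subsetP => j; rewrite !inE mxE [j == i]eq_sym.
    by case: (i == j); rewrite ?eqxx.
  by rewrite cards1.
by exists 1%:M, 0; split; rewrite ?addr0 ?trmx1 ?mxrank0.
Qed.

Lemma rigidity_le m (A : 'M[K]_m) (r : {nonneg R}) (b : R) :
  0 <= b -> decomp A r%:num b -> (rigidity A r)%:R <= b.
Proof.
move=> b0 [E [F [AE rE cE rF]]]; rewrite /rigidity; case: ex_minnP => s _ smin.
rewrite -truncn_ge_nat //; apply: smin; apply/asboolP; exists E, F; split => //.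
split=> [i|j]; rewrite truncn_ge_nat //.
suff -> : [set i | E i j != 0] = [set i | E^T j i != 0] by [].
by apply/setP => i; rewrite !inE mxE.
Qed.

End Decomposition.

(** * Counting by weights, and bounds on the exponential *)

Lemma card_le_sum (R : numDomainType) (T : finType) (S : {set T}) (v : T -> R) :
  (forall x, 0 <= v x) -> (forall x, x \in S -> 1 <= v x) ->
  #|S|%:R <= \sum_x v x.
Proof.
move=> v0 v1; rewrite -sum1_card natr_sum (bigID (mem S) xpredT) /=.
by rewrite -[leLHS]addr0 lerD ?ler_sum ?sumr_ge0.
Qed.

(** This is [1 - x <= expR (- x)] raised to the power [m]; it yields rational upper bounds on the
    exponential. *)
Lemma expR_le_inv (R : realType) (m : nat) (x : R) :
  x < 1 -> expR (m%:R * x) * (1 - x) ^+ m <= 1.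
Proof.
move=> x1; rewrite -[leRHS](mulVf (lt0r_neq0 (expR_gt0 (- (m%:R * x))))) -expRN.
rewrite opprK ler_pM2l ?expR_gt0 // -mulrN expRM_natl.
rewrite lerXn2r ?nnegrE ?expR_ge0 //.
  by rewrite subr_ge0 ltW.
exact: expR_ge1Dx.
Qed.

Lemma expR_le_quad (R : realType) (x : R) :
  `|x| <= 1 / 100 -> expR x <= 1 + x + 2 / 3 * x ^+ 2.
Proof.
rewrite ler_norml => /andP[xl xu].
(* The quadratic coefficient of [(1 - x / m)^-m] is [(m + 1) / (2 m)], and [m = 4] is the least [m]
   that brings it below [2 / 3]. *)
have [v vE] : exists v, x = 4 * v by exists (x / 4); field.
rewrite {x}vE in xl xu *.
have e4 : expR (4 * v) * (1 - v) ^+ 4 <= 1 by apply: (@expR_le_inv R 4); lra.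
pose Q : R := 1 + 4 * v + 2 / 3 * (4 * v) ^+ 2.
have Q0 : 0 <= Q by rewrite /Q; nra.
have v2 : 0 <= v ^+ 2 by rewrite sqr_ge0.
have Q1 : 1 <= (1 - v) ^+ 4 * Q.
  have -> : (1 - v) ^+ 4 * Q = 1 + v ^+ 2 * (2 / 3 - 68 / 3 * v
      + v ^+ 2 * (49 - 116 / 3 * v + 32 / 3 * v ^+ 2)) by rewrite /Q; field.
  rewrite lerDl mulr_ge0 // addr_ge0 //; first by lra.
  by rewrite mulr_ge0 //; lra.
rewrite -/Q; have := ler_wpM2l (expR_ge0 (4 * v)) Q1.
rewrite mulr1 mulrA => /le_trans; apply.
by rewrite -[leRHS]mul1r ler_wpM2r.
Qed.

(** * Chernoff bounds and the splitting of one Kronecker power *)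

Section Coordinates.
Variables (R : realType) (d n : nat) (k : 'I_d).
Implicit Types x y : {ffun 'I_n -> 'I_d}.

Definition kcount x : nat := #|[set i | x i == k]|.

Lemma sum_kcount x (c : R) : \sum_i c * (x i == k)%:R = c * (kcount x)%:R.
Proof.
rewrite -mulr_sumr -natr_sum /kcount -sum1_card [in RHS]big_mkcond.
by congr (_ * _%:R); apply: eq_bigr => i _; rewrite inE; case: (x i == k).
Qed.

(** The sign of [l] selects the tail: dividing the premise by [l] gives [kcount x] at least
    [(1 + 4/3 l) n/d] for [l > 0], at most that for [l < 0]. In the exponent, [4/3 l^2] from the
    threshold minus [2/3 l^2] from [expR_le_quad] leaves [2/3 l^2]. *)
Lemma card_kcount_tail (S : {set {ffun 'I_n -> 'I_d}}) (l : R) :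
  `|l| <= 1 / 100 ->
  (forall x, x \in S ->
     (l + 4 / 3 * l ^+ 2) * n%:R / d%:R <= l * (kcount x)%:R) ->
  #|S|%:R <= d%:R ^+ n * expR (- (2 / 3 * l ^+ 2 * n%:R / d%:R)).
Proof.
move=> l100 hS.
have d0 : 0 < d%:R :> R by rewrite ltr0n (leq_ltn_trans _ (ltn_ord k)).
set a := (l + _) * _ / _ in hS.
pose v x := expR (- a) * \prod_i expR (l * (x i == k)%:R).
apply: (@le_trans _ _ (\sum_x v x)).
  apply: card_le_sum => x => [|xS]; rewrite /v -expR_sum -expRD ?expR_ge0 //.
  by rewrite sum_kcount -[leLHS]expR0 ler_expR addrC subr_ge0 hS.
rewrite -mulr_sumr -(bigA_distr_bigA (fun _ j => expR (l * (j == k)%:R))) /=.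
rewrite prodr_const card_ord (bigD1 k) //= eqxx mulr1.
rewrite (eq_bigr (fun=> 1)) => [|j /negPf->]; last by rewrite mulr0 expR0.
rewrite sumr_const cardC1 card_ord.
have el := expR_le_quad l100.
have -> : expR l + d.-1%:R = d%:R * (1 + (expR l - 1) / d%:R).
  have dE : d%:R = d.-1%:R + 1 :> R by rewrite natr1 (ltn_predK (ltn_ord k)).
  transitivity (d%:R + (expR l - 1)); first by rewrite dE; ring.
  by field; rewrite gt_eqF.
rewrite exprMn mulrCA ler_pM2l ?exprn_gt0 //.
have e1 : 0 <= 1 + (expR l - 1) / d%:R.
  rewrite addrC -lerBlDr sub0r ler_pdivlMr // mulN1r lerBrDr.
  have : 1 <= d%:R :> R by rewrite ler1n -(ltr0n R).
  by have := expR_ge0 l; lra.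
apply: (@le_trans _ _ (expR (- a) * expR ((expR l - 1) / d%:R) ^+ n)).
  by rewrite ler_pM2l ?expR_gt0 // lerXn2r ?nnegrE ?expR_ge0 ?expR_ge1Dx.
rewrite -expRM_natl -expRD ler_expR /a.
have : (expR l - 1) / d%:R <= (l + 2 / 3 * l ^+ 2) / d%:R.
  by rewrite ler_pM2r ?invr_gt0 //; lra.
have n0 : 0 <= n%:R :> R by [].
move=> /(ler_wpM2l n0) /(lerD (lexx (- a))) /le_trans; apply.
by rewrite /a le_eqVlt; apply/orP; left; apply/eqP; field; rewrite gt_eqF.
Qed.

(* Contains the support of the Kronecker power of any matrix that is the
   identity outside row [k]. *)
Definition kpre x y := [forall i, (x i == y i) || (x i == k)].

(** The product over [i] of [wt t (x i) (y i)] vanishes unless [kpre x y], and is then [t] to the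
    number of places where [x] and [y] differ. *)
Let wt (t : R) (a b : 'I_d) : R :=
  if a == b then 1 else if a == k then t else 0.

(** Under [kpre x y], wherever [y i = k] also [x i = k], so [x] and [y] differ in exactly
    [kcount x - kcount y] places. *)
Lemma kpre_weight (tau D : R) x y :
  0 <= tau -> kpre x y -> (kcount x)%:R - (kcount y)%:R <= D ->
  1 <= expR (tau * D) * \prod_i wt (expR (- tau)) (x i) (y i).
Proof.
move=> tau0 /forallP xy xyD.
have -> : \prod_i wt (expR (- tau)) (x i) (y i) =
    \prod_i expR (- tau * ((x i == k)%:R - (y i == k)%:R)).
  apply: eq_bigr => i _; have := xy i; rewrite /wt eq_sym.
  case: eqP => [->|ne] /=; first by rewrite subrr mulr0 expR0.
  move=> /eqP xk; rewrite xk eqxx; case: eqP => [yk|_].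
    by rewrite xk yk in ne.
  by rewrite subr0 mulr1.
rewrite -expR_sum -mulr_sumr sumrB -expRD -[leLHS]expR0 ler_expR.
have := sum_kcount x 1; have := sum_kcount y 1.
under eq_bigr do rewrite mul1r.
under [X in _ -> X = _ -> _]eq_bigr do rewrite mul1r.
rewrite !mul1r => -> ->.
by rewrite mulNr -mulrBr mulr_ge0 // subr_ge0.
Qed.

Lemma wt_ge0 (t : R) a b : 0 <= t -> 0 <= wt t a b.
Proof. by rewrite /wt; do 2 case: ifP => //. Qed.

(** Summed over [y], the weight factors over coordinates: [1 + (d - 1) t] where [x i = k], and [1]
    elsewhere. *)
Lemma card_kpre_row x (tau D c : R) : 0 <= tau -> (kcount x)%:R <= c ->
  #|[set y | kpre x y && ((kcount x)%:R - (kcount y)%:R <= D)]|%:R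
    <= expR (tau * D + d.-1%:R * expR (- tau) * c).
Proof.
move=> tau0 xc; set t := expR (- tau).
apply: le_trans (card_le_sum (v := fun y =>
  expR (tau * D) * \prod_i wt t (x i) (y i)) _ _) _.
- move=> y; rewrite mulr_ge0 ?expR_ge0 ?prodr_ge0 // => i _.
  by rewrite wt_ge0 ?expR_ge0.
- move=> y; rewrite inE => /andP[xy xyD].
  exact: kpre_weight.
rewrite -mulr_sumr -(bigA_distr_bigA (fun i j => wt t (x i) j)) /= expRD.
rewrite ler_pM2l ?expR_gt0 //.
apply: (@le_trans _ _ (\prod_i expR (d.-1%:R * t * (x i == k)%:R))).
  apply: ler_prod => i _; rewrite sumr_ge0 => [|j _]; last first.
    by rewrite wt_ge0 ?expR_ge0.
  rewrite (bigD1 (x i)) //= {1}/wt eqxx.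
  apply: le_trans (expR_ge1Dx _); rewrite lerD2l.
  rewrite (eq_bigr (fun=> t * (x i == k)%:R)).
    by rewrite sumr_const cardC1 card_ord -[_ *+ d.-1]mulr_natl mulrA.
  move=> j; rewrite /wt eq_sym => /negPf->.
  by case: ifP => _; rewrite ?mulr1 ?mulr0.
by rewrite -expR_sum sum_kcount ler_expR ler_wpM2l // mulr_ge0 ?expR_ge0.
Qed.

(** For fixed [y], the only alternative to [x i = y i] is [x i = k], so every coordinate contributes
    at most [1 + t]. *)
Lemma card_kpre_col y (tau D : R) : 0 <= tau ->
  #|[set x | kpre x y && ((kcount x)%:R - (kcount y)%:R <= D)]|%:R
    <= expR (tau * D + expR (- tau) * n%:R).
Proof.
move=> tau0; set t := expR (- tau).
apply: le_trans (card_le_sum (v := fun x =>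
  expR (tau * D) * \prod_i wt t (x i) (y i)) _ _) _.
- move=> x; rewrite mulr_ge0 ?expR_ge0 ?prodr_ge0 // => i _.
  by rewrite wt_ge0 ?expR_ge0.
- move=> x; rewrite inE => /andP[xy xyD].
  exact: kpre_weight.
rewrite -mulr_sumr -(bigA_distr_bigA (fun i j => wt t j (y i))) /= expRD.
rewrite ler_pM2l ?expR_gt0 //.
apply: (@le_trans _ _ (\prod_(i < n) expR t)).
  apply: ler_prod => i _; rewrite sumr_ge0 => [|j _]; last first.
    by rewrite wt_ge0 ?expR_ge0.
  rewrite (bigD1 (y i)) //= {1}/wt eqxx.
  apply: le_trans (expR_ge1Dx _); rewrite lerD2l.
  rewrite (eq_bigr (fun j => if j == k then t else 0)); last first.
    by move=> j /negPf yj; rewrite /wt yj.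
  rewrite -big_mkcondr /=; case: (eqVneq k (y i)) => [kyi|kyi].
    rewrite big_pred0 ?expR_ge0 // => j; rewrite kyi.
    by case: eqP.
  rewrite (big_pred1 k) // => j /=.
  by case: (j =P k) => [->|]; rewrite ?kyi ?andbF.
by rewrite prodr_const card_ord -expRM_natr.
Qed.

End Coordinates.

(* [8 / 3 * l / d] is the width, relative to [n], of the window kept around the
   mean [n / d] of [kcount]; the Chernoff exponents are [l] and [- l]. *)
Lemma decomp_ntensmx_row (R : realType) (K : fieldType) (d n : nat) (k : 'I_d)
    (G : 'M[K]_d) (l tau : R) :
  (forall i j, i != k -> G i j = (i == j)%:R) ->
  0 < l <= 1 / 100 -> 0 <= tau -> expR (- tau) <= 8 / 3 * l / d%:R ->
  decomp (G ^t n) (2 * (d%:R ^+ n * expR (- (2 / 3 * l ^+ 2 * n%:R / d%:R))))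
    (expR (8 / 3 * l * n%:R / d%:R * (tau + (1 + 4 / 3 * l)))).
Proof.
move=> hG /andP[l0 l1] tau0 taul.
have dN : (0 < d)%N by rewrite (leq_ltn_trans _ (ltn_ord k)).
have d0 : 0 < d%:R :> R by rewrite ltr0n.
have n0 : 0 <= n%:R :> R by [].
have [g bijg gE] := ntensmx_digits d n.
pose z (x : {ffun 'I_n -> 'I_d}) : R := (kcount k x)%:R.
pose hi : R := (1 + 4 / 3 * l) * n%:R / d%:R.
pose lo : R := (1 - 4 / 3 * l) * n%:R / d%:R.
pose D : R := 8 / 3 * l * n%:R / d%:R.
have hiD : hi - lo = D by rewrite /hi /lo /D; field; rewrite gt_eqF.
pose A := G ^t n.
have supp x y : A x y != 0 -> kpre k (g x) (g y).
  rewrite /A gE => /prodf_neq0 nz; apply/forallP => i.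
  by apply: contraR (nz i isT) => /norP[ne nk]; rewrite hG // (negPf ne).
pose P x y := (z (g x) <= hi) && (lo <= z (g y)).
pose E := \matrix_(x, y) (if P x y then A x y else 0).
pose F1 := \matrix_(x, y) (if z (g x) <= hi then 0 else A x y).
(* Rows already in [F1] are excluded, so [E], [F1] and [F2] have disjoint supports. *)
pose F2 := \matrix_(x, y)
  (if (z (g x) <= hi) && ~~ (lo <= z (g y)) then A x y else 0).
have EP x y : E x y != 0 -> [/\ kpre k (g x) (g y), z (g x) <= hi &
    z (g x) - z (g y) <= D].
  rewrite mxE /P; case: ifP => [/andP[xhi ylo] /supp xy|_];
    last by rewrite eqxx.
  by split => //; rewrite -hiD lerB.
exists E, (F1 + F2); split.
- apply/matrixP => x y; rewrite !mxE /P -/A.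
  by case: (z (g x) <= hi); case: (lo <= z (g y)); rewrite /= ?addr0 ?add0r.
- move=> x; case: (lerP (z (g x)) hi) => [xhi|xhi]; last first.
    rewrite (_ : [set _ | _] = set0) ?cards0 ?expR_ge0 //.
    apply/setP => y; rewrite !inE; apply/negbTE/negP => /EP[_ + _].
    by rewrite leNgt xhi.
  apply: (@le_trans _ _ (expR (tau * D + d.-1%:R * expR (- tau) * hi))).
    apply: le_trans (card_kpre_row D tau0 xhi); rewrite ler_nat.
    rewrite -(on_card_preimset (onW_bij _ bijg)); apply: subset_leq_card.
    by apply/subsetP => y; rewrite !inE => /EP[-> _ ->].
  rewrite ler_expR.
  (* With this bound the row exponent becomes [D * (tau + 1 + 4/3 l)]; the columns below need only
     [D * (tau + 1)]. *)
  have le1 : d.-1%:R * expR (- tau) <= 8 / 3 * l.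
    apply: (@le_trans _ _ (d%:R * (8 / 3 * l / d%:R))).
      by rewrite ler_pM ?expR_ge0 // ler_nat leq_pred.
    by rewrite mulrC divfK ?gt_eqF.
  have hi0 : 0 <= hi by rewrite /hi divr_ge0 // mulr_ge0 //; lra.
  have := ler_wpM2r hi0 le1; rewrite -(lerD2l (tau * D)) => /le_trans; apply.
  rewrite le_eqVlt; apply/orP; left; apply/eqP.
  by rewrite /hi /D; field; rewrite gt_eqF.
- move=> y; apply: (@le_trans _ _ (expR (tau * D + expR (- tau) * n%:R))).
    apply: le_trans (card_kpre_col k (g y) D tau0); rewrite ler_nat.
    rewrite -(on_card_preimset (onW_bij _ bijg)); apply: subset_leq_card.
    by apply/subsetP => x; rewrite !inE mxE => /EP[-> _ ->].
  rewrite ler_expR; have := ler_wpM2r n0 taul.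
  rewrite -(lerD2l (tau * D)) => /le_trans; apply.
  have -> : tau * D + 8 / 3 * l / d%:R * n%:R = D * (tau + 1).
    by rewrite /D; field; rewrite gt_eqF.
  rewrite -/D ler_wpM2l //; last lra.
  by rewrite /D divr_ge0 // mulr_ge0 //; lra.
- pose S1 := [set x : {ffun 'I_n -> 'I_d} | ~~ (z x <= hi)].
  pose S2 := [set x : {ffun 'I_n -> 'I_d} | ~~ (lo <= z x)].
  have r1 : (\rank F1 <= #|S1|)%N.
    rewrite -(on_card_preimset (onW_bij _ bijg)).
    by apply: mxrank_le_rows => x y; rewrite !inE negbK mxE => ->.
  have r2 : (\rank F2 <= #|S2|)%N.
    rewrite -(on_card_preimset (onW_bij _ bijg)).
    apply: mxrank_le_cols => x y; rewrite !inE negbK mxE => ->.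
    by rewrite andbF.
  apply: (@le_trans _ _ (#|S1|%:R + #|S2|%:R)).
    by rewrite -natrD ler_nat (leq_trans (mxrank_add _ _)) // leq_add.
  rewrite mulr_natl mulr2n; apply: lerD.
    apply: (@card_kcount_tail _ _ _ k).
      by rewrite ger0_norm // ltW.
    move=> x; rewrite inE -ltNge => /ltW xhi.
    apply: le_trans (ler_wpM2l (ltW l0) xhi).
    by rewrite /hi le_eqVlt; apply/orP; left; apply/eqP; field; rewrite gt_eqF.
  rewrite -sqrrN; apply: (@card_kcount_tail _ _ _ k).
    by rewrite normrN ger0_norm // ltW.
  move=> x; rewrite inE -ltNge => /ltW xlo.
  have lN : - l <= 0 by lra.
  apply: le_trans (ler_wnM2l lN xlo).
  by rewrite /lo le_eqVlt; apply/orP; left; apply/eqP; field; rewrite gt_eqF.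
Qed.

(** * Factoring the DFT matrix into matrices that differ from the identity in one row *)

Section Factorization.
Variables (K : fieldType) (w : K) (d : nat).
Hypothesis w_prim : d.-primitive_root w.

Definition DFT_top (k : nat) : 'M[K]_d :=
  \matrix_(i, j) if (i < k)%N then DFT w d i j else (i == j)%:R.

(** For [v] in the left kernel, the first [k] columns say that the polynomial with coefficients
    [v 0 i], [i < k], vanishes at the [k] distinct points [w ^+ j]. So these coefficients are zero,
    and the other columns then kill the rest of [v]. *)
Lemma DFT_top_unit (k : nat) : (k <= d)%N -> DFT_top k \in unitmx.
Proof.
move=> kd; rewrite -row_free_unit; apply/inj_row_free => v vM.
have hv (j : 'I_d) : \sum_i v 0 i * DFT_top k i j = 0.
  by have /rowP/(_ j) := vM; rewrite !mxE.
have lowE (j : 'I_d) : (j < k)%N ->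
    \sum_(i < d | (i < k)%N) v 0 i * w ^+ (i * j) = 0.
  move=> jk; rewrite -[RHS](hv j) [RHS](bigID (fun i : 'I_d => i < k)%N) /=.
  rewrite [X in _ = _ + X]big1 ?addr0 => [|i ik].
    by apply: eq_bigr => i ik; rewrite !mxE ik.
  rewrite !mxE (negPf ik); case: eqP => [ij|]; last by rewrite mulr0.
  by rewrite ij jk in ik.
pose p := \poly_(i < k) (if insub i is Some i' then v 0 i' else 0).
have rootp (j : 'I_d) : (j < k)%N -> root p (w ^+ j).
  move=> jk; apply/eqP; rewrite horner_poly -[RHS](lowE j jk).
  rewrite (big_ord_widen d
    (fun i => (if insub i is Some i' then v 0 i' else 0) * (w ^+ j) ^+ i)) //.
  by apply: eq_bigr => i _; rewrite valK -exprM mulnC.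
have p0 : p = 0.
  apply/eqP; apply/negPn/negP => pn0.
  have := @max_poly_roots _ p [seq w ^+ (j : nat) | j <- iota 0 k] pn0.
  rewrite size_map size_iota => /(_ _ _)/wrap[].
  - apply/allP => _ /mapP[j + ->]; rewrite mem_iota /= add0n => jk.
    exact: (rootp (Ordinal (leq_trans jk kd))).
  - rewrite map_inj_in_uniq ?iota_uniq // => i j.
    rewrite !mem_iota /= !add0n => ik jk /eqP.
    rewrite (eq_prim_root_expr w_prim) !modn_small ?(leq_trans _ kd) //.
    by move/eqP.
  - by rewrite ltnNge size_poly.
have vlow (i : 'I_d) : (i < k)%N -> v 0 i = 0.
  move=> ik; have : p`_i = 0 by rewrite p0 coef0.
  by rewrite coef_poly ik valK.
apply/rowP => j; rewrite [RHS]mxE; case: (ltnP j k) => [/vlow //|kj].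
have := hv j; rewrite (bigD1 j) //= big1 ?addr0 => [|i ij].
  by rewrite mxE ltnNge kj /= eqxx mulr1.
by rewrite mxE; case: ltnP => [/vlow->|]; rewrite ?mul0r // (negPf ij) mulr0.
Qed.

Lemma decomp_DFT (R : realType) (n : nat) (r b : R) :
  (forall (k : 'I_d) (G : 'M[K]_d),
    (forall i j, i != k -> G i j = (i == j)%:R) ->
    decomp (G ^t n) r b) ->
  decomp (DFT w d ^t n) (d%:R * r) (b ^+ d).
Proof.
move=> hG.
have step k : (k <= d)%N -> decomp (DFT_top k ^t n) (k%:R * r) (b ^+ k).
  elim: k => [|k IH] kd.
    have -> : DFT_top 0 = 1%:M by apply/matrixP => i j; rewrite !mxE.
    by rewrite ntensmx_scalar1 mul0r expr0; apply: decomp1.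
  have uk := DFT_top_unit (ltnW kd).
  rewrite -(mulmxKV uk (DFT_top k.+1)) ntensmxM -natr1 addrC mulrDl mul1r exprS.
  apply: decompM (IH (ltnW kd)); apply: (hG (Ordinal kd)) => i j ik.
  (* Away from row [k], [DFT_top k.+1] and [DFT_top k] have equal rows, so the quotient has the rows
     of the identity there. *)
  have -> : (i == j)%:R = (DFT_top k *m invmx (DFT_top k)) i j.
    by rewrite mulmxV // mxE.
  rewrite !mxE; apply: eq_bigr => m _; congr (_ * _).
  rewrite !mxE ltnS leq_eqVlt.
  have /negPf-> // : (i : nat) != k.
  by apply: contra ik => /eqP ik; apply/eqP/val_inj.
have -> : DFT w d = DFT_top d by apply/matrixP => i j; rewrite !mxE ltn_ord.
exact: step.
Qed.

End Factorization.

(** * Numerical estimates and the choice of parameters *)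

Lemma expR_ge_pow (R : realType) (m : nat) (x : R) :
  0 <= x -> (1 + x) ^+ m <= expR (m%:R * x).
Proof.
move=> x0; rewrite expRM_natl.
by rewrite lerXn2r ?nnegrE ?expR_ge0 ?addr_ge0 ?expR_ge1Dx.
Qed.

(** Rests on [e^4 <= (6/5)^24 < 100]; the next lemma rests likewise on
    [e^(13/20) <= (187/200)^-10 < 2]. *)
Lemma ln_ge4 (R : realType) (x : R) : 100 <= x -> 4 <= ln x.
Proof.
move=> hx; have x0 : 0 < x by lra.
rewrite -ler_expR lnK ?posrE //; apply: le_trans hx.
have := @expR_le_inv R 24 (1 / 6).
rewrite (_ : 24 * (1 / 6) = 4 :> R); last by field.
have := expR_ge0 (4 : R); rewrite !exprS expr0; lra.
Qed.

Lemma ln_nat_ge (R : realType) (d : nat) :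
  (2 <= d)%N -> 13 / 20 <= ln d%:R :> R.
Proof.
move=> d2; have d2R : 2 <= d%:R :> R by rewrite (ler_nat _ 2).
rewrite -ler_expR lnK ?posrE; last by lra.
apply: le_trans d2R; have := @expR_le_inv R 10 (13 / 200).
rewrite (_ : 10 * (13 / 200) = 13 / 20 :> R); last by field.
have := expR_ge0 (13 / 20 : R); rewrite !exprS expr0; lra.
Qed.

(** The tangent line at [x = 4], the lower bound later available for [L], with [ln (40/3)] rounded
    up to [14/5]. *)
Lemma ln_mul_le (R : realType) (x : R) :
  0 < x -> ln (10 / 3 * x) <= x / 4 + 9 / 5.
Proof.
move=> x0; rewrite -ler_expR lnK ?posrE; last by lra.
have -> : x / 4 + 9 / 5 = x / 4 - 1 + 14 / 5 by field.
have h1 : x / 4 <= expR (x / 4 - 1) by have := expR_ge1Dx (x / 4 - 1); lra.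
have h2 : 40 / 3 <= expR (14 / 5 : R).
  have := @expR_ge_pow R 28 (1 / 10).
  rewrite (_ : 28 * (1 / 10) = 14 / 5 :> R); last by field.
  by rewrite !exprS expr0; lra.
rewrite expRD; apply: (@le_trans _ _ (x / 4 * (40 / 3))); first by lra.
by apply: ler_pM => //; lra.
Qed.

Lemma decomp_Hmx (R : realType) (K : fieldType) (w : K) (d n : nat) (eps : R) :
  (2 <= d)%N -> d.-primitive_root w -> 0 < eps < 1 / 100 ->
  1 / psi d eps <= n%:R ->
  decomp (Hmx w d n) ((d ^ n)%:R `^ (1 - psi d eps)) ((d ^ n)%:R `^ eps).
Proof.
move=> d2 w_prim /andP[e0 e1] npsi.
have d0 : 0 < d%:R :> R by rewrite ltr0n (leq_trans _ d2).
have N0 : 0 < (d ^ n)%:R :> R by rewrite ltr0n expn_gt0 (leq_trans _ d2).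
have lnN : ln (d ^ n)%:R = n%:R * ln d%:R :> R.
  by rewrite natrX lnXn // mulr_natl.
have powN x : (d ^ n)%:R `^ x = expR (x * (n%:R * ln d%:R)) :> R.
  by rewrite /powR gt_eqF // lnN.
have lnd := ln_nat_ge R d2.
set L := ln (1 / eps).
have L4 : 4 <= L by rewrite ln_ge4 // ler_pdivlMr //; lra.
have lnd0 : 0 < ln d%:R :> R by lra.
(* The constant in [8 / 3 * l = 3 / 10 * eps / L] is small enough for the
   sparsity bound, while the Chernoff exponent [27 / 8 * T] leaves [19 / 8 * T]
   to absorb the factor [2 * d] in the rank. *)
pose l : R := 9 / 80 * eps / L.
have L0 : 0 < L by lra.
have l0 : 0 < l by apply: divr_gt0 => //; lra.
have lL : l * L = 9 / 80 * eps by rewrite /l divfK ?gt_eqF.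
have l1 : l <= 1 / 1000 by nra.
pose T : R := psi d eps * (n%:R * ln d%:R).
have TE : 2 / 3 * l ^+ 2 * n%:R / d%:R = 27 / 8 * T.
  by rewrite /T /psi -/L /l; field; rewrite !gt_eqF.
have psi0 : 0 < psi d eps.
  have h400 : 0 < 400 :> R by lra.
  exact: divr_gt0 (exprn_gt0 2 e0)
    (mulr_gt0 (mulr_gt0 (mulr_gt0 h400 (exprn_gt0 2 L0)) d0) lnd0).
(* This is where [n >= 1 / psi] enters: it gives [2 <= d <= expR T], so the rank factor [2 * d]
   costs at most [expR (2 * T)]. *)
have Tge : ln d%:R <= T.
  rewrite /T mulrA -[leLHS]mul1r ler_pM2r // mulrC.
  by move: npsi; rewrite ler_pdivrMr.
(* Solves [expR tau = 10/3 * L * d / eps], which is the inverse of [8/3 * l / d]. *)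
pose tau : R := ln (10 / 3 * L) + (ln d%:R + L).
have tauE : expR (- tau) = 8 / 3 * l / d%:R.
  have pos1 : 0 < 1 / eps by rewrite divr_gt0.
  have pos2 : 0 < 10 / 3 * L by lra.
  rewrite expRN /tau !expRD !lnK ?posrE //.
  by rewrite /l; field; rewrite !gt_eqF.
have tau_le : tau <= L / 4 + 9 / 5 + (ln d%:R + L) by rewrite lerD2r ln_mul_le.
have tau0 : 0 <= tau.
  by have : 0 <= ln (10 / 3 * L) by [apply: ln_ge0; lra]; rewrite /tau; lra.
have l01 : 0 < l <= 1 / 100 by rewrite l0 (le_trans l1) //; lra.
have tau1 : expR (- tau) <= 8 / 3 * l / d%:R by rewrite tauE.
apply: decomp_le (decomp_DFT w_prim (fun k G hG =>
  decomp_ntensmx_row n hG l01 tau0 tau1)); last first.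
  rewrite -expRM_natl powN ler_expR.
  have -> : d%:R * (8 / 3 * l * n%:R / d%:R * (tau + (1 + 4 / 3 * l))) =
      n%:R * (8 / 3 * l * (tau + (1 + 4 / 3 * l))) by field; rewrite gt_eqF.
  rewrite [leRHS]mulrCA ler_wpM2l // -(ler_pM2r L0).
  have -> : 8 / 3 * l * (tau + (1 + 4 / 3 * l)) * L =
      eps * (3 / 10 * (tau + (1 + 4 / 3 * l))).
    by rewrite -mulrA [_ * L]mulrC mulrA -(mulrA (8 / 3)) lL; field.
  rewrite -[leRHS]mulrA ler_pM2l //.
  (* What remains is [3/10 * (tau + 1 + 4/3 l) <= ln d * L]; this product bounds the nonlinear term
     [ln d * L] below by a linear one. *)
  have : 0 <= (L - 4) * (ln d%:R - 13 / 20) by rewrite mulr_ge0 // subr_ge0.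
  lra.
rewrite powN mulrBl mul1r -/T expRD -lnN lnK ?posrE // TE natrX.
have d2R : 2 <= d%:R :> R by rewrite (ler_nat _ 2).
have dT : d%:R <= expR T by rewrite -[leLHS]lnK ?posrE // ler_expR.
have key : d%:R * 2 * expR (- (27 / 8 * T)) <= expR (- T).
  apply: (@le_trans _ _ (expR T * expR T * expR (- (27 / 8 * T)))).
    by rewrite ler_wpM2r ?expR_ge0 // ler_pM // (le_trans d2R).
  by rewrite -!expRD ler_expR; lra.
have -> : d%:R * (2 * (d%:R ^+ n * expR (- (27 / 8 * T)))) =
    d%:R ^+ n * (d%:R * 2 * expR (- (27 / 8 * T))) by ring.
by rewrite ler_wpM2l // exprn_ge0.
Qed.

Theorem theorem7p21 (R : realType) (F : finFieldType) (q : nat)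
    (hq : #|F| = q) (d n N : nat) (hd : (2 <= d)%N) (hn : (0 < n)%N)
    (hN : N = (d ^ n)%N) (hdq : gcdn d q = 1%N)
    (L : fieldExtType F) (w : L) (hw : d.-primitive_root w)
    (eps : R) (heps0 : 0 < eps) (heps : eps < 1 / 100)
    (hpsi : 1 / psi d eps <= n%:R) :
  (rigidity (Hmx (adjoin_gen w) d n) (N%:R `^ (1 - psi d eps))%:nng)%:R
    <= N%:R `^ eps :> R.
Proof.
apply: rigidity_le; first exact: powR_ge0.
rewrite /= hN; apply: decomp_Hmx => //; last by rewrite heps0.
(* The embedding of [F[w]] into [L] sends [adjoin_gen w] to [w] and reflects primitive roots. *)
by rewrite -(fmorph_primitive_root (@vsval _ _ <<1; w>>%AS)).
Qed.
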